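(* Let $(M,g)$ be a pseudo-Riemannian manifold, let $\nabla$ be the Levi-Civita connection of $g$ and let $J$ be a $g$-symmetric $(1,1)$-tensor field on $M$. Assume that $J$ is invertible and let $\tilde g$ be the twin metric defined by $g$ and $J$, $\tilde g(X,Y)=g(X,JY)$. Then $(M,\tilde g,\nabla)$ is a statistical manifold if and only if $$(\nabla_XJ)Y=(\nabla_YJ)X$$ for all vector fields $X,Y$ on $M$.
   Context: $J$ is $g$-symmetric if $g(JX,Y)=g(X,JY)$ for all $X,Y$. $(M,h,\nabla)$, with $h$ a non-degenerate symmetric $(0,2)$-tensor field and $\nabla$ a torsion-free affine connection, is a statistical manifold if $(\nabla_Xh)(Y,Z)=(\nabla_Yh)(X,Z)$ for all vector fields $X,Y,Z$. *)

(* Defs.v *)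
From HB Require Import structures.
From mathcomp Require Import all_boot all_order all_algebra.
From mathcomp Require Import all_classical all_reals all_analysis.
From mathcomp Require Import ring.

Set Implicit Arguments.
Unset Strict Implicit.
Unset Printing Implicit Defensive.

Import Order.TTheory GRing.Theory Num.Theory.
Import numFieldNormedType.Exports.

Local Open Scope classical_set_scope.
Local Open Scope ring_scope.

Section SmoothOn.
Context {R : realType} {V W : normedModType R}.

Fixpoint Ck_on (k : nat) (U : set V) (f : V -> W) : Prop :=
  (forall x, U x -> {for x, continuous f}) /\
  (if k is k'.+1 then
     forall v, (forall x, U x -> derivable f x v) /\ Ck_on k' U ('D_v f)
   else True).

(* Only meaningful for an open set [U]. *)
Definition smooth_on (U : set V) (f : V -> W) : Prop := forall k, Ck_on k U f.

End SmoothOn.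

Section SmoothOnTheory.
Context {R : realType} {V : normedModType R} (U : set V).
Hypothesis oU : open U.

Lemma Ck_on_ext k (f g : V -> R) :
  (forall x, U x -> f x = g x) -> Ck_on k U f -> Ck_on k U g.
Proof.
have nfg (f' g' : V -> R) x :
    (forall x, U x -> f' x = g' x) -> U x -> {near x, f' =1 g'}.
  by move=> fg Ux; near=> y; apply: fg; near: y; exact: open_nbhs_nbhs.
have cfg (f' g' : V -> R) : (forall x, U x -> f' x = g' x) ->
    (forall x, U x -> {for x, continuous f'}) ->
    forall x, U x -> {for x, continuous g'}.
  move=> fg cf x Ux; have := cvg_trans (near_eq_cvg (nfg _ _ _ fg Ux)) (cf x Ux).
  by rewrite (fg x Ux); apply; exact: nbhs_filter.
elim: k f g => [|k IH] f g fg [cf df]; split => //; try exact: cfg cf.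
move=> v; have [dfv Cf] := df v; split=> [x Ux|].
  exact: near_eq_derivable (nfg _ _ _ fg Ux) (dfv x Ux).
by apply: IH Cf => x Ux; exact: near_eq_derive (nfg _ _ _ fg Ux).
Unshelve. all: by end_near. Qed.

Lemma Ck_onW k (f : V -> R) : Ck_on k.+1 U f -> Ck_on k U f.
Proof.
elim: k f => [|k IH] f; first by case.
by case=> cf df; split=> // v; have [d1 d2] := df v; split=> //; exact: IH.
Qed.

Lemma Ck_on_cst k (c : R) : Ck_on k U (fun=> c).
Proof.
elim: k c => [|k IH] c; split=> //; try by move=> x _; exact: cvg_cst.
move=> v; split=> [x _|]; first exact: derivable_cst.
by apply: Ck_on_ext (IH 0) => x _; rewrite derive_cst.
Qed.

Lemma Ck_onD k (f g : V -> R) :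
  Ck_on k U f -> Ck_on k U g -> Ck_on k U (f + g).
Proof.
elim: k f g => [|k IH] f g [cf df] [cg dg]; split=> //;
  try by move=> x Ux; apply: cvgD; [exact: cf|exact: cg].
move=> v; have [df1 df2] := df v; have [dg1 dg2] := dg v.
split=> [x Ux|]; first by apply: derivableD; [exact: df1|exact: dg1].
apply: Ck_on_ext (IH _ _ df2 dg2) => x Ux.
by rewrite deriveD//; [exact: df1|exact: dg1].
Qed.

Lemma Ck_onM k (f g : V -> R) :
  Ck_on k U f -> Ck_on k U g -> Ck_on k U (f * g).
Proof.
elim: k f g => [|k IH] f g Cf Cg; have [cf df] := Cf; have [cg dg] := Cg;
  split=> //; try by move=> x Ux; apply: cvgM; [exact: cf|exact: cg].
move=> v; have [df1 df2] := df v; have [dg1 dg2] := dg v.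
split=> [x Ux|]; first by apply: derivableM; [exact: df1|exact: dg1].
apply: Ck_on_ext (Ck_onD (IH _ _ (Ck_onW Cf) dg2) (IH _ _ (Ck_onW Cg) df2)).
by move=> x Ux; rewrite deriveM//; [exact: df1|exact: dg1].
Qed.

End SmoothOnTheory.

Record chart (R : realType) (n : nat) (T : topologicalType) := Chart {
  chart_dom : set T;
  chart_map : T -> 'rV[R]_n;
  chart_inv : 'rV[R]_n -> T;
  chart_dom_open : open chart_dom;
  chart_img_open : open (chart_map @` chart_dom);
  chart_mapK : {in chart_dom, cancel chart_map chart_inv};
  chart_map_cont : {within chart_dom, continuous chart_map};
  chart_inv_cont : {within chart_map @` chart_dom, continuous chart_inv} }.

(* The atlas need not be maximal; it determines the smooth structure. *)
Record manifold (R : realType) (n : nat) := Manifold {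
  points :> topologicalType;
  manifold_hausdorff : hausdorff_space points;
  manifold_second_countable : @second_countable points;
  atlas : set (chart R n points);
  atlas_cover : forall p : points, exists2 a, atlas a & chart_dom a p;
  atlas_compatible : forall a b, atlas a -> atlas b ->
    smooth_on (chart_map a @` (chart_dom a `&` chart_dom b))
              (chart_map b \o chart_inv a) }.

Section Manifold.
Context {R : realType} {n : nat} (M : manifold R n).

Definition smooth : {pred M -> R} := fun f => `[<
  forall a : chart R n M, atlas a ->
    smooth_on (chart_map a @` chart_dom a) (f \o chart_inv a) >].

Lemma smooth_cst (c : R) : (fun=> c) \in smooth.
Proof. by apply/asboolP => a _ k; apply: Ck_on_cst; exact: chart_img_open. Qed.

Lemma smoothD f g : f \in smooth -> g \in smooth -> f + g \in smooth.
Proof.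
move=> /asboolP sf /asboolP sg; apply/asboolP => a Aa k.
exact: (Ck_onD (@chart_img_open _ _ _ a) (sf a Aa k) (sg a Aa k)).
Qed.

Lemma smoothM f g : f \in smooth -> g \in smooth -> f * g \in smooth.
Proof.
move=> /asboolP sf /asboolP sg; apply/asboolP => a Aa k.
exact: (Ck_onM (@chart_img_open _ _ _ a) (sf a Aa k) (sg a Aa k)).
Qed.

Lemma smoothZ (c : R) f : f \in smooth -> c *: f \in smooth.
Proof. by move=> sf; apply: (smoothM (smooth_cst c) sf). Qed.

Lemma smoothB f g : f \in smooth -> g \in smooth -> f - g \in smooth.
Proof.
move=> sf sg; apply: smoothD => //.
by rewrite -scaleN1r; exact: smoothZ.
Qed.

Fact smooth_subring : subring_closed smooth.
Proof. by split; [exact: (smooth_cst 1)|exact: smoothB|exact: smoothM]. Qed.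
HB.instance Definition _ := GRing.isSubringClosed.Build _ smooth smooth_subring.
HB.instance Definition _ := GRing.isScaleClosed.Build R _ smooth smoothZ.

Record smoothFun := SmoothFun {
  smooth_fun :> M -> R;
  smooth_funP : smooth_fun \in smooth }.

HB.instance Definition _ := [isSub for smooth_fun].
HB.instance Definition _ := [Choice of smoothFun by <:].
HB.instance Definition _ := GRing.SubChoice_isSubComPzRing.Build
  (M -> R) smooth smoothFun (subringClosedP _).
HB.instance Definition _ := [SubZmodule_isSubLmodule of smoothFun by <:].

(* Vector fields are the derivations of the algebra of smooth functions:
   [fun f => X f p] is the tangent vector [X_p], a derivation at [p]; that
   [X f] is again a smooth function is the smoothness of [p |-> X_p]. *)
Definition derivation : {pred smoothFun -> smoothFun} := fun X => `[<
  (forall (c : R) (f f' : smoothFun), X (c *: f + f') = c *: X f + X f') /\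
  (forall f f' : smoothFun, X (f * f') = X f * f' + f * X f') >].

Fact derivationZ (h : smoothFun) X : X \in derivation ->
  (fun f => h * X f) \in derivation.
Proof.
move=> /asboolP[XL XM]; apply/asboolP; split=> [c f f'|f f'].
  rewrite XL mulrDr; congr (_ + _); apply/val_inj/funext => p /=.
  exact: mulrCA.
by rewrite XM mulrDr mulrA [h * (f * _)]mulrCA.
Qed.

Fact derivation_zmod : zmod_closed derivation.
Proof.
split.
  apply/asboolP; split=> [c f f'|f f'].
    by rewrite scaler0 addr0.
  by rewrite mul0r mulr0 addr0.
move=> X Y /asboolP[XL XM] /asboolP[YL YM]; apply/asboolP.
split=> [c f f'|f f'].
  by rewrite !fctE XL YL scalerBr opprD addrACA.
by rewrite !fctE XM YM mulrBl mulrBr opprD addrACA.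
Qed.
HB.instance Definition _ :=
  GRing.isZmodClosed.Build _ derivation derivation_zmod.

Record vectorField := VectorField {
  vector_field :> smoothFun -> smoothFun;
  vector_fieldP : vector_field \in derivation }.

HB.instance Definition _ := [isSub for vector_field].
HB.instance Definition _ := [Choice of vectorField by <:].
HB.instance Definition _ := [SubChoice_isSubZmodule of vectorField by <:].

Definition vf_scale (h : smoothFun) (X : vectorField) : vectorField :=
  VectorField (derivationZ h (vector_fieldP X)).

Fact vf_scaleA a b X : vf_scale a (vf_scale b X) = vf_scale (a * b) X.
Proof. by apply/val_inj/funext => f /=; rewrite mulrA. Qed.
Fact vf_scale1 : left_id 1 vf_scale.
Proof. by move=> X; apply/val_inj/funext => f /=; rewrite mul1r. Qed.
Fact vf_scaleDr : right_distributive vf_scale +%R.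
Proof. by move=> a X Y; apply/val_inj/funext => f /=; rewrite mulrDr. Qed.
Fact vf_scaleDl X : {morph vf_scale^~ X : a b / a + b}.
Proof. by move=> a b; apply/val_inj/funext => f /=; rewrite mulrDl. Qed.
HB.instance Definition _ := GRing.Zmodule_isLmodule.Build smoothFun vectorField
  vf_scaleA vf_scale1 vf_scaleDr vf_scaleDl.

Fact lie_derivation (X Y : vectorField) :
  (fun f => X (Y f) - Y (X f)) \in derivation.
Proof.
have /asboolP[XL XM] := vector_fieldP X; have /asboolP[YL YM] := vector_fieldP Y.
have XD u v : X (u + v) = X u + X v by have := XL 1 u v; rewrite !scale1r.
have YD u v : Y (u + v) = Y u + Y v by have := YL 1 u v; rewrite !scale1r.
apply/asboolP; split=> [c f f'|f f'].
  by rewrite YL XL XL YL scalerBr opprD addrACA.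
rewrite XM YM XD YD !XM !YM; apply/val_inj/funext => p /=.
rewrite /GRing.mul /GRing.add /GRing.opp /=.
ring.
Qed.

Definition lie (X Y : vectorField) : vectorField :=
  VectorField (lie_derivation X Y).

(* Tensor fields are the maps on vector fields that are multilinear over the
   ring of smooth functions. *)
Definition tensor02 (h : vectorField -> vectorField -> smoothFun) : Prop :=
  (forall (f : smoothFun) (X Y Z : vectorField),
     h (f *: X + Y) Z = f * h X Z + h Y Z) /\
  (forall (f : smoothFun) (X Y Z : vectorField),
     h Z (f *: X + Y) = f * h Z X + h Z Y).

Definition tensor11 (J : vectorField -> vectorField) : Prop :=
  forall (f : smoothFun) (X Y : vectorField), J (f *: X + Y) = f *: J X + J Y.

Definition symmetric02 (h : vectorField -> vectorField -> smoothFun) : Prop :=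
  forall X Y, h X Y = h Y X.

(* Non-degeneracy of the bilinear form at every single point [p]: the
   hypothesis on [X] is [h_p (X_p, -) = 0] and the conclusion is [X_p = 0].
   All tangent vectors are covered, each being the value of a vector field;
   quantifying over [p] last, [h X _ = 0 -> X = 0], would be weaker. *)
Definition nondegenerate (h : vectorField -> vectorField -> smoothFun) : Prop :=
  forall (p : M) (X : vectorField),
    (forall Y : vectorField, h X Y p = 0) -> forall f : smoothFun, X f p = 0.

(* The index is not required to be constant; it is locally constant anyway. *)
Definition pseudo_riemannian (g : vectorField -> vectorField -> smoothFun) :
    Prop :=
  [/\ tensor02 g, symmetric02 g & nondegenerate g].

Definition connection (D : vectorField -> vectorField -> vectorField) : Prop :=
  [/\ forall (f : smoothFun) (X Y Z : vectorField),
        D (f *: X + Y) Z = f *: D X Z + D Y Z,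
      forall X Y Z : vectorField, D X (Y + Z) = D X Y + D X Z &
      forall (f : smoothFun) (X Y : vectorField),
        D X (f *: Y) = X f *: Y + f *: D X Y].

Definition torsion_free (D : vectorField -> vectorField -> vectorField) :
    Prop :=
  forall X Y, D X Y - D Y X = lie X Y.

Definition cov02 (D : vectorField -> vectorField -> vectorField)
    (h : vectorField -> vectorField -> smoothFun) (X Y Z : vectorField) :
    smoothFun :=
  X (h Y Z) - h (D X Y) Z - h Y (D X Z).

Definition cov11 (D : vectorField -> vectorField -> vectorField)
    (J : vectorField -> vectorField) (X Y : vectorField) : vectorField :=
  D X (J Y) - J (D X Y).

Definition levi_civita (g : vectorField -> vectorField -> smoothFun)
    (D : vectorField -> vectorField -> vectorField) : Prop :=
  [/\ connection D, torsion_free D & forall X Y Z, cov02 D g X Y Z = 0].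

Definition statistical (h : vectorField -> vectorField -> smoothFun)
    (D : vectorField -> vectorField -> vectorField) : Prop :=
  [/\ [/\ tensor02 h, symmetric02 h & nondegenerate h],
      connection D /\ torsion_free D &
      forall X Y Z, cov02 D h X Y Z = cov02 D h Y X Z].

Definition g_symmetric (g : vectorField -> vectorField -> smoothFun)
    (J : vectorField -> vectorField) : Prop :=
  forall X Y, g (J X) Y = g X (J Y).

Definition invertible11 (J : vectorField -> vectorField) : Prop :=
  exists K : vectorField -> vectorField,
    [/\ tensor11 K, cancel J K & cancel K J].

Definition twin_metric (g : vectorField -> vectorField -> smoothFun)
    (J : vectorField -> vectorField) : vectorField -> vectorField -> smoothFun :=
  fun X Y => g X (J Y).

End Manifold.

(* Main.v *)
(* Metricity of nabla gives (nabla_X g~)(Y, Z) = g(Z, (nabla_X J) Y), so the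
   Codazzi equation for g~ says that (nabla_X J) Y - (nabla_Y J) X is
   g-orthogonal to every vector field, i.e. vanishes. *)
Require Import Defs.
From mathcomp Require Import all_boot all_order all_algebra.
From mathcomp Require Import all_classical all_reals all_analysis.

Set Implicit Arguments.
Unset Strict Implicit.
Unset Printing Implicit Defensive.

Import GRing.Theory.
Local Open Scope ring_scope.

Section TwinMetric.
Context {R : realType} {n : nat} (M : manifold R n).
Implicit Types (g : vectorField M -> vectorField M -> smoothFun M)
  (nabla : vectorField M -> vectorField M -> vectorField M)
  (J : vectorField M -> vectorField M) (X Y Z W : vectorField M).

Lemma tensor02Br g X Y Z : tensor02 g -> g X (Y - Z) = g X Y - g X Z.
Proof.
by move=> [_ gr]; rewrite addrC -scaleN1r gr mulN1r addrC.
Qed.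

(** Vector fields are derivations, so [W] vanishes once [W f p] does for all [f] and [p];
    non-degeneracy gives this at each point separately. *)
Lemma nondegenerate_eq0 g W : Defs.nondegenerate g -> (forall Y, g W Y = 0) -> W = 0.
Proof.
move=> ndg gW0; apply/val_inj/funext => f; apply/val_inj/funext => p.
by apply: (ndg p W) => Y; rewrite gW0.
Qed.

Lemma tensor02_twin_metric g J :
  tensor02 g -> tensor11 J -> tensor02 (twin_metric g J).
Proof.
move=> [gl gr] JT; split=> f X Y Z; rewrite /twin_metric; first exact: gl.
by rewrite JT gr.
Qed.

Lemma symmetric02_twin_metric g J :
  symmetric02 g -> g_symmetric g J -> symmetric02 (twin_metric g J).
Proof. by move=> gC Jsym X Y; rewrite /twin_metric -Jsym gC. Qed.

(** Every [Y] is [J (K Y)], so orthogonality at [p] to all fields for the twin metric is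
    orthogonality at [p] to all fields for [g]. *)
Lemma nondegenerate_twin_metric g J :
  Defs.nondegenerate g -> invertible11 J -> Defs.nondegenerate (twin_metric g J).
Proof.
move=> ndg [K [_ _ KK]] p X gX0; apply: ndg => Y.
by rewrite -(KK Y); exact: gX0.
Qed.

Lemma cov02_twin_metric g nabla J X Y Z :
  tensor02 g -> symmetric02 g -> g_symmetric g J ->
  (forall X Y Z, cov02 nabla g X Y Z = 0) ->
  cov02 nabla (twin_metric g J) X Y Z = g Z (cov11 nabla J X Y).
Proof.
move=> gT gC Jsym metric; rewrite /cov02 /twin_metric /cov11 tensor02Br//.
(* Metricity on the pair [Z], [J Y] trades [g Z (nabla X (J Y))] for terms in which [J Y] is not
   differentiated. *)
have /eqP := metric X Z (J Y); rewrite /cov02 subr_eq0 => /eqP <-.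
(* Moving [J] off [Z] and [nabla X Z] leaves both sides equal up to the order of the last two
   terms. *)
by rewrite -[g Y (J Z)]Jsym -[g (nabla X Y) _]Jsym -[g Y (J _)]Jsym
  ![g (J _) _]gC addrAC.
Qed.

End TwinMetric.

Theorem proposition5p3 (R : realType) (n : nat) (M : manifold R n)
    (g : vectorField M -> vectorField M -> smoothFun M)
    (nabla : vectorField M -> vectorField M -> vectorField M)
    (J : vectorField M -> vectorField M)
    (g_metric : pseudo_riemannian g)
    (nabla_LC : levi_civita g nabla)
    (J_tensor : tensor11 J)
    (J_sym : g_symmetric g J)
    (J_inv : invertible11 J) :
  statistical (twin_metric g J) nabla <->
  (forall X Y : vectorField M, cov11 nabla J X Y = cov11 nabla J Y X).
Proof.
have [gT gC ndg] := g_metric; have [conn tf metric] := nabla_LC.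
have covE X Y Z := cov02_twin_metric X Y Z gT gC J_sym metric.
split=> [[_ _ codazzi] X Y|codazzi].
  apply/eqP; rewrite -subr_eq0; apply/eqP/(nondegenerate_eq0 ndg) => Z.
  (* Symmetry of [g] puts the difference in the second slot, the one that [covE] can read. *)
  by rewrite gC tensor02Br// -!covE codazzi subrr.
(* Conversely, [covE] reduces the Codazzi equation of the twin metric to the assumed one, paired
   with [Z]. *)
split=> [|//|X Y Z]; last by rewrite !covE codazzi.
split; first exact: tensor02_twin_metric.
  exact: symmetric02_twin_metric.
exact: nondegenerate_twin_metric.
Qed.
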